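(* Let $q$ be any one of the following query types: equivalence, subset, superset, membership. Let $C_1,\dots,C_k$ be concept classes over sets $X_1,\dots,X_k$, and assume each $C_i$ is learnable (by an algorithm $A_i$ using only queries of type $q$) from $\#q_i$ many queries of type $q$. Then there exists an algorithm, using only queries of type $q$, that can learn any disjoint union of concepts $\bigsqcup_{i=1}^k c_i$, i.e. any target in the class $\{\bigsqcup_{i=1}^k c_i\mid c_i\in C_i\}$ over $\bigsqcup_{i=1}^k X_i$, in (at most) $\sum_{i=1}^k\#q_i$ many queries.
   Context: A concept class over a set $X$ is a set of subsets of $X$ (concepts). For a class $D$ over a set $Y$ with unknown target $c^*\in D$, the query types are: membership query: given $x\in Y$, the oracle says whether $x\in c^*$; equivalence query: given $c\in D$, the oracle returns `true' if $c=c^*$, and otherwise some element of $(c\setminus c^* )\cup(c^*\setminus c)$; subset query: given $c\in D$, the oracle returns `true' if $c\subseteq c^*$, and otherwise some element of $c\setminus c^*$; superset query: given $c\in D$, the oracle returns `true' if $c\supseteq c^*$, and otherwise some element of $c^*\setminus c$. Counterexamples are chosen arbitrarily (possibly adversarially). A learning algorithm for $D$ is an adaptive query strategy that, for every target $c^*\in D$ and every valid oracle behaviour, stops after finitely many queries and outputs $c^*$; complexity is measured only by the number of oracle queries. $\#q_i$ is the (worst-case over valid oracle behaviours) number of queries made by $A_i$ to learn its target. $\bigsqcup$ denotes disjoint union. *)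

(* Defs.v *)
From mathcomp Require Import all_boot.
From mathcomp Require Import boolp classical_sets.

Set Implicit Arguments.
Unset Strict Implicit.
Unset Printing Implicit Defensive.

Local Open Scope classical_set_scope.

Variant query_type :=
  EquivalenceQuery | SubsetQuery | SupersetQuery | MembershipQuery.

Definition query (t : query_type) (X : Type) : Type :=
  if t is MembershipQuery then X else set X.

(* For the non-membership queries [None] is the answer "true" and [Some x] is
   the counterexample [x]. *)
Definition answer (t : query_type) (X : Type) : Type :=
  if t is MembershipQuery then bool else option X.

(* Queried concepts must belong to the class (proper queries); any point of the
   domain may be the subject of a membership query. *)
Definition admissible (t : query_type) (X : Type) (D : set (set X)) :
    query t X -> Prop :=
  match t return query t X -> Prop with
  | MembershipQuery => fun _ => True
  | _ => fun c => D c
  end.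

Definition valid_answer (t : query_type) (X : Type) (target : set X) :
    query t X -> answer t X -> Prop :=
  match t return query t X -> answer t X -> Prop with
  | EquivalenceQuery => fun c a =>
      if a is Some x then ((c `\` target) `|` (target `\` c)) x
      else c = target
  | SubsetQuery => fun c a =>
      if a is Some x then (c `\` target) x else c `<=` target
  | SupersetQuery => fun c a =>
      if a is Some x then (target `\` c) x else target `<=` c
  | MembershipQuery => fun x b => b = true <-> target x
  end.

Variant action (t : query_type) (X : Type) : Type :=
  | Ask of query t X
  | Output of set X.

(* The next action, given the answers received so far, oldest first; earlier
   queries need not be recorded since the strategy determines them. *)
Definition strategy (t : query_type) (X : Type) : Type :=
  seq (answer t X) -> action t X.

(* The answer sequences that can arise when [A] interacts with some valid,
   possibly adaptive, oracle for [target]; the length of a transcript is the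
   number of queries made. *)
Inductive transcript (t : query_type) (X : Type) (A : strategy t X)
    (target : set X) : seq (answer t X) -> Prop :=
  | transcript_nil : transcript A target [::]
  | transcript_rcons h x a :
      transcript A target h -> A h = Ask x -> valid_answer target x a ->
      transcript A target (rcons h a).

Definition terminates (t : query_type) (X : Type) (A : strategy t X)
    (target : set X) : Prop :=
  forall a : nat -> answer t X, exists n, ~ transcript A target (mkseq a n).

(* A valid answer to any query always exists, so that termination together with
   the second conjunct means that every run ends by outputting the target. *)
Definition learns (t : query_type) (X : Type) (D : set (set X))
    (A : strategy t X) : Prop :=
  forall target, D target ->
    terminates A target /\
    forall h, transcript A target h ->
      match A h with
      | Ask x => admissible D x
      | Output c => c = target
      end.

Definition queries_at_most (t : query_type) (X : Type) (A : strategy t X)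
    (target : set X) (n : nat) : Prop :=
  forall h, transcript A target h -> size h <= n.

Definition disjoint_union (k : nat) (X : 'I_k -> Type)
    (c : forall i, set (X i)) : set {i : 'I_k & X i} :=
  [set p | c (tag p) (tagged p)].

Definition disjoint_union_class (k : nat) (X : 'I_k -> Type)
    (C : forall i, set (set (X i))) : set (set {i : 'I_k & X i}) :=
  [set u | exists2 c : forall i, set (X i),
             (forall i, C i (c i)) & u = disjoint_union c].

(* Main.v *)
(* Run all the learners side by side on their own components.  Each query of the
   combined learner serves at least one unfinished learner, and its answer is
   passed on, as a valid answer to the pending query, to exactly one of them: a
   counterexample goes to the component it lies in (a finished learner proposes
   its true target there, so it gets no counterexample), while "true", or the
   answer to a membership query, goes to one chosen unfinished learner.  Hence
   the number of queries is the sum of the lengths of the component runs. *)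
Require Import Defs.
From mathcomp Require Import all_boot.
From mathcomp Require Import boolp classical_sets.

Set Implicit Arguments.
Unset Strict Implicit.
Unset Printing Implicit Defensive.

Local Open Scope classical_set_scope.

(** An arbitrary answer, used only as a default for [nth]. *)
Definition answer0 (t : query_type) (X : Type) : answer t X :=
  match t return answer t X with MembershipQuery => false | _ => None end.

Lemma transcript_prefix (t : query_type) (X : Type) (A : strategy t X)
    (target : set X) (h1 h2 : seq (answer t X)) :
  transcript A target (h1 ++ h2) -> transcript A target h1.
Proof.
elim/last_ind: h2 => [|h2 a IHh2]; first by rewrite cats0.
rewrite -rcons_cat => hA; apply: IHh2.
case E: _ / hA => [|h x b hA _ _].
  by move/(congr1 size): E; rewrite size_rcons.
by case/rcons_inj: E => ->.
Qed.

(** If the lengths were unbounded, the growing histories would converge to an infinite answer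
    sequence with all prefixes transcripts, which termination forbids. *)
Lemma terminates_bounded (t : query_type) (X : Type) (A : strategy t X)
    (target : set X) (s : nat -> seq (answer t X)) :
  terminates A target -> (forall n, transcript A target (s n)) ->
  (forall n, exists r, s n.+1 = s n ++ r) ->
  exists b, forall n, size (s n) <= b.
Proof.
move=> termA trs grow; apply: contrapT => unbounded.
have /choice[f ltf] : forall m, exists n, m < size (s n).
  move=> m; apply: contrapT => Nm; apply: unbounded; exists m => n.
  by rewrite leqNgt; apply/negP => ltm; apply: Nm; exists n.
have growD n d : exists r, s (n + d) = s n ++ r.
  elim: d => [|d [r IHd]]; first by exists [::]; rewrite addn0 cats0.
  have [r' E] := grow (n + d); exists (r ++ r').
  by rewrite addnS E IHd catA.
pose x0 := answer0 t X.
have nth_s m n n' :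
    m < size (s n) -> n <= n' -> nth x0 (s n') m = nth x0 (s n) m.
  move=> ltm /subnKC <-; have [r ->] := growD n (n' - n).
  by rewrite nth_cat ltm.
(* The limit sequence: entry [m] is read from [s (f m)], which is long enough to have one. By
   [nth_s] any other long enough history gives the same entry. *)
have [m []] := termA (fun m => nth x0 (s (f m)) m).
suff -> : mkseq (fun m => nth x0 (s (f m)) m) m = take m (s (f m)).
  by apply: (@transcript_prefix _ _ _ _ _ (drop m (s (f m))));
    rewrite cat_take_drop.
have szm : size (take m (s (f m))) = m by rewrite size_takel // ltnW.
apply: (@eq_from_nth _ x0); rewrite size_mkseq ?szm // => i lti.
rewrite nth_mkseq // nth_take //.
have ltfm : i < size (s (f m)) by apply: ltn_trans lti (ltf m).
by case/orP: (leq_total (f i) (f m)) => le; rewrite (nth_s _ _ _ _ le).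
Qed.

Section Combination.
Variables (k : nat) (X : 'I_k -> Type).

Definition asks (t : query_type) (Y : Type) (a : action t Y) : bool :=
  if a is Ask _ then true else false.

(* Junk value [set0] on [Ask]. *)
Definition output (t : query_type) (Y : Type) (a : action t Y) : set Y :=
  if a is Output c then c else set0.

(* [j] is the learner to be served; it is assumed to be asking.  A finished
   learner contributes its output to the combined concept. *)
Definition combine (t : query_type) (j : 'I_k) :
    (forall i, action t (X i)) -> action t {i : 'I_k & X i} :=
  match t return (forall i, action t (X i)) -> action t {i : 'I_k & X i} with
  | MembershipQuery => fun acts =>
      match acts j with
      | Ask x => @Ask MembershipQuery _ (Tagged X x)
      | Output _ => Output _ set0
      end
  | EquivalenceQuery => fun acts => @Ask EquivalenceQuery _ (disjoint_union
      (fun i => match acts i with Ask c => c | Output c => c end))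
  | SubsetQuery => fun acts => @Ask SubsetQuery _ (disjoint_union
      (fun i => match acts i with Ask c => c | Output c => c end))
  | SupersetQuery => fun acts => @Ask SupersetQuery _ (disjoint_union
      (fun i => match acts i with Ask c => c | Output c => c end))
  end.

(** A dependent pair, since a counterexample itself determines the recipient, possibly other than
    [j], and the answer type varies with the recipient. *)
Definition route (t : query_type) (j : 'I_k) :
    answer t {i : 'I_k & X i} -> {i : 'I_k & answer t (X i)} :=
  match t return answer t {i : 'I_k & X i} -> {i : 'I_k & answer t (X i)} with
  | MembershipQuery => fun b => existT (fun=> bool) j b
  | _ => fun a =>
      if a is Some p
      then existT (fun i => option (X i)) (tag p) (Some (tagged p))
      else existT (fun i => option (X i)) j None
  end.

Definition sound_action (t : query_type) (Y : Type) (D : set (set Y))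
    (target : set Y) (a : action t Y) : Prop :=
  match a with Ask x => admissible D x | Output c => c = target end.

(** A finished learner has output its target, which lies in its class, so filling its slot with that
    output keeps the combined query proper. *)
Lemma combine_sound (t : query_type)
    (C : forall i, set (set (X i))) (c : forall i, set (X i))
    (acts : forall i, action t (X i)) (j : 'I_k) :
  (forall i, C i (c i)) -> (forall i, sound_action (C i) (c i) (acts i)) ->
  asks (acts j) ->
  exists2 q, combine j acts = Ask q & admissible (disjoint_union_class C) q.
Proof.
rewrite /combine; case: t acts => acts Cc sound asks_j.
1-3: by eexists; first reflexivity; eexists; last reflexivity; move=> i;
  case: (acts i) (sound i) => //= ? ->.
by case: (acts j) asks_j => // x _; exists (Tagged X x).
Qed.

(** Differences and inclusions of disjoint unions are computed componentwise, so answers about the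
    union restrict to answers about components. *)
Lemma route_valid (t : query_type)
    (C : forall i, set (set (X i))) (c : forall i, set (X i))
    (acts : forall i, action t (X i)) (j : 'I_k)
    (q : query t {i : 'I_k & X i}) (a : answer t {i : 'I_k & X i}) :
  (forall i, sound_action (C i) (c i) (acts i)) -> asks (acts j) ->
  combine j acts = Ask q -> valid_answer (disjoint_union c) q a ->
  exists2 x, acts (tag (route j a)) = Ask x &
    valid_answer (c (tag (route j a))) x (tagged (route j a)).
Proof.
rewrite /combine /route; case: t acts q a => acts q a sound asks_j.
- case=> <-; case: a => [[i x]|] /=.
    rewrite /disjoint_union /setU /setD /=.
    (* If learner [i] had finished, its slot would equal [c i] and could not contain a
       counterexample. *)
    by case: (acts i) (sound i) => [d _|d ->]; [exists d|case=> -[]].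
  case Ej: (acts j) asks_j => [d|] // _ E; exists d => //.
  rewrite predeqE => x.
  have := congr1 (fun u : set _ => u (Tagged X x)) E.
  by rewrite /disjoint_union /= Ej => ->.
- case=> <-; case: a => [[i x]|] /=.
    rewrite /disjoint_union /setD /=.
    by case: (acts i) (sound i) => [d _|d ->]; [exists d|case].
  case Ej: (acts j) asks_j => [d|] // _ sub; exists d => // x.
  by have := sub (Tagged X x); rewrite /disjoint_union /= Ej.
- case=> <-; case: a => [[i x]|] /=.
    rewrite /disjoint_union /setD /=.
    by case: (acts i) (sound i) => [d _|d ->]; [exists d|case].
  case Ej: (acts j) asks_j => [d|] // _ sup; exists d => // x.
  by have := sup (Tagged X x); rewrite /disjoint_union /= Ej.
- by case: (acts j) asks_j => // x _ [<-]; exists x.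
Qed.

Variables (t : query_type) (A : forall i : 'I_k, strategy t (X i)).
Arguments A : clear implicits.

Definition histories := forall i : 'I_k, seq (answer t (X i)).

Definition actions (hs : histories) (i : 'I_k) : action t (X i) := A i (hs i).
Arguments actions : clear implicits.

Definition served (hs : histories) : option 'I_k :=
  [pick j | asks (actions hs j)].

(** The last branch is junk: with no learner left to serve, no query is made. *)
Definition dispatch (hs : histories) (a : answer t {i : 'I_k & X i}) :
    histories :=
  if served hs is Some j then
    let p := route j a in
    dfwith hs (rcons (hs (tag p)) (tagged p))
  else hs.

(** A strategy sees only past answers, so the component runs are recovered by replaying them from
    the start. *)
Definition split_history (h : seq (answer t {i : 'I_k & X i})) : histories :=
  foldl dispatch (fun=> [::]) h.

Definition parallel : strategy t {i : 'I_k & X i} := fun h =>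
  let acts := actions (split_history h) in
  if served (split_history h) is Some j then combine j acts
  else Output _ (disjoint_union (fun i => output (acts i))).

Lemma dispatch_grows (hs : histories) (a : answer t {i : 'I_k & X i}) i :
  exists r, dispatch hs a i = hs i ++ r.
Proof.
rewrite /dispatch; case: served => [j|]; last by exists [::]; rewrite cats0.
case: (route j a) => l b /=; case: dfwithP => [|i' _].
  by exists [:: b]; rewrite cats1.
by exists [::]; rewrite cats0.
Qed.

Variable C : forall i : 'I_k, set (set (X i)).
Arguments C : clear implicits.
Hypothesis learnsA : forall i, learns (C i) (A i).

Section Target.
Variable c : forall i : 'I_k, set (X i).
Arguments c : clear implicits.
Hypothesis Cc : forall i, C i (c i).

Lemma actions_sound (hs : histories) :
  (forall i, transcript (A i) (c i) (hs i)) ->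
  forall i, sound_action (C i) (c i) (actions hs i).
Proof. by move=> tr i; have [_] := learnsA (Cc i); apply. Qed.

Lemma split_history_transcript (h : seq (answer t {i : 'I_k & X i})) :
  transcript parallel (disjoint_union c) h ->
  (forall i, transcript (A i) (c i) (split_history h i)) /\
  \sum_(i < k) size (split_history h i) = size h.
Proof.
elim=> [|{}h q a _ [IHtr IHsize]].
  by split=> [i|]; [apply: transcript_nil|rewrite big1].
rewrite /parallel /split_history foldl_rcons -/(split_history h) size_rcons.
(* Some learner is asking, since otherwise [parallel] would output instead of asking [q]. *)
rewrite /dispatch /served; case: pickP => // j asks_j Eq val_a.
have [x Ex val_x] := route_valid (actions_sound IHtr) asks_j Eq val_a.
case: (route j a) x Ex val_x => l b x /= Ex val_x; split=> [i|].
  by case: dfwithP => //; apply: transcript_rcons Ex val_x.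
rewrite -IHsize (bigD1 l) //= [in RHS](bigD1 l) //= dfwith_in size_rcons addSn.
by congr (_ + _).+1; apply: eq_bigr => i Nil; rewrite dfwith_out // eq_sym.
Qed.

Lemma parallel_sound (h : seq (answer t {i : 'I_k & X i})) :
  transcript parallel (disjoint_union c) h ->
  match parallel h with
  | Ask q => admissible (disjoint_union_class C) q
  | Output u => u = disjoint_union c
  end.
Proof.
move=> /split_history_transcript[/actions_sound sound _].
rewrite /parallel /served; case: pickP => [j asks_j|noask].
  by have [q -> Dq] := combine_sound Cc sound asks_j.
(* With no learner asking, every action is an output, hence correct by soundness. *)
congr disjoint_union; apply: functional_extensionality_dep => i.
by case: (actions _ i) (noask i) (sound i).
Qed.

(** Along an infinite run each component history stays bounded by [terminates_bounded], while their
    total length is the number of queries made. *)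
Lemma parallel_terminates : terminates parallel (disjoint_union c).
Proof.
move=> a; apply: contrapT => /forallNP/= trN.
have tr n : transcript parallel (disjoint_union c) (mkseq a n).
  exact: contrapT (trN n).
pose s n := split_history (mkseq a n).
have /choice[b leb] : forall i, exists b, forall n, size (s n i) <= b.
  move=> i; have [termA _] := learnsA (Cc i).
  apply: terminates_bounded termA _ _ => n.
    by have [] := split_history_transcript (tr n).
  by rewrite /s mkseqS /split_history foldl_rcons; apply: dispatch_grows.
(* One query more than the component bounds allow in total. *)
pose n := (\sum_(i < k) b i).+1.
have [_ sz] := split_history_transcript (tr n).
have : \sum_(i < k) size (s n i) <= \sum_(i < k) b i by apply: leq_sum.
by rewrite sz size_mkseq ltnn.
Qed.

Lemma parallel_queries (nq : 'I_k -> nat) :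
  (forall i, queries_at_most (A i) (c i) (nq i)) ->
  queries_at_most parallel (disjoint_union c) (\sum_(i < k) nq i).
Proof.
move=> leA h /split_history_transcript[tr <-].
by apply: leq_sum => i _; apply: leA.
Qed.

End Target.

Lemma parallel_learns : learns (disjoint_union_class C) parallel.
Proof.
move=> _ [c Cc ->]; split; first exact: parallel_terminates.
exact: parallel_sound.
Qed.

End Combination.

Theorem proposition10 (t : query_type) (k : nat) (X : 'I_k -> Type)
    (C : forall i : 'I_k, set (set (X i)))
    (A : forall i : 'I_k, strategy t (X i)) :
  (forall i : 'I_k, learns (C i) (A i)) ->
  exists B : strategy t {i : 'I_k & X i},
    learns (disjoint_union_class C) B /\
    forall (c : forall i : 'I_k, set (X i)) (nq : 'I_k -> nat),
      (forall i : 'I_k, C i (c i)) ->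
      (forall i : 'I_k, queries_at_most (A i) (c i) (nq i)) ->
      queries_at_most B (disjoint_union c) (\sum_(i < k) nq i).
Proof.
move=> learnsA; exists (parallel A); split; first exact: parallel_learns.
by move=> c nq Cc; apply: parallel_queries learnsA _ Cc _.
Qed.
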